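(* Let $\phi_0(t),\phi_1(t),\ldots,\phi_n(t)$ be differentiable real-valued functions of $t\in\mathbb{R}$, let $\Phi(t)=(\phi_0(t),\phi_1(t),\ldots,\phi_n(t))^T$, and suppose that $\Omega=\mathrm{span}\{\phi_0(t),\phi_1(t),\ldots,\phi_n(t)\}$ is closed with respect to differentiation. Let $h$ be an arbitrary real number. Then $$\Omega=\mathrm{span}\{\phi_0(t+h),\phi_1(t+h),\ldots,\phi_n(t+h)\},$$ and there exists a constant (independent of $t$) $(n+1)\times(n+1)$ matrix $C_h$ such that $\Phi(t+h)=C_h\Phi(t)$ for all $t\in\mathbb{R}$.
   Context: Spans are linear spans over $\mathbb{R}$ of functions of $t\in\mathbb{R}$; $\phi_i(t+h)$ denotes the function $t\mapsto\phi_i(t+h)$. The space $\Omega$ is closed with respect to differentiation if $f\in\Omega$ implies $f'\in\Omega$. *)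

(* Defs.v *)
From HB Require Import structures.
From mathcomp Require Import all_boot all_order all_algebra.
From mathcomp Require Import all_classical all_reals all_analysis.

Set Implicit Arguments.
Unset Strict Implicit.
Unset Printing Implicit Defensive.

Import Order.TTheory GRing.Theory Num.Theory.
Import numFieldNormedType.Exports.
Local Open Scope classical_set_scope.
Local Open Scope ring_scope.

(* MathComp's [span] lives in a finite-dimensional [vectType], which [R -> R]
   is not. The family may be linearly dependent. *)
Definition fun_span (R : realType) (m : nat) (phi : 'I_m -> R -> R) :
    set (R -> R) :=
  [set f | exists c : 'I_m -> R, f = fun t => \sum_(i < m) c i * phi i t].

(* [derive1 f t] takes an unspecified value if [f] is not differentiable at [t], so this
   is meaningful for spaces of differentiable functions only. *)
Definition closed_under_differentiation (R : realType) (Omega : set (R -> R)) :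
    Prop :=
  forall f : R -> R, Omega f -> Omega (derive1 f).

Definition fun_col (R : realType) (m : nat) (phi : 'I_m -> R -> R) (t : R) :
    'cV[R]_m :=
  \col_(i < m) phi i t.

(* Main.v *)
Require Import Defs.
From HB Require Import structures.
From mathcomp Require Import all_boot all_order all_algebra.
From mathcomp Require Import all_classical all_reals all_analysis.
From mathcomp Require Import ring lra.

Set Implicit Arguments.
Unset Strict Implicit.
Unset Printing Implicit Defensive.

Import Order.TTheory GRing.Theory Num.Theory.
Import numFieldNormedType.Exports.
Local Open Scope classical_set_scope.
Local Open Scope ring_scope.

(* Closure under differentiation gives [Phi' = A Phi] for a constant matrix [A].
   Choose points [s_k] such that the vectors [Phi(s_k)] span all values of [Phi].
   If [Phi(t) = \sum_k w_k Phi(s_k)], then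
   [u |-> Phi(t + u) - \sum_k w_k Phi(s_k + u)] solves [y' = A y] with [y(0) = 0],
   hence vanishes identically, so [Phi(t + h) = \sum_k w_k Phi(s_k + h)]. Since [w]
   can be taken linear in [Phi(t)], so is [Phi(t + h)]. *)

(** With the integrating factor [expR (- K * t)], the product [g] has derivative
    [expR (- K * t) * (dE t - K * E t) <= 0]. The mean value theorem on [[0, t]] then gives
    [g t <= g 0 = E 0 <= 0], and the exponential is positive. *)
Lemma gronwall_le0 (R : realType) (E dE : R -> R) (K : R) :
  (forall t : R, is_derive t 1 E (dE t)) -> (forall t, dE t <= K * E t) ->
  E 0 <= 0 -> forall t, 0 <= t -> E t <= 0.
Proof.
move=> hE hle E0 t; rewrite le_eqVlt => /predU1P[<-//|t0].
pose g := E * (expR \o (- K \*: id)).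
have hg (x : R) : is_derive x 1 g (expR (- K * x) * (dE x - K * E x)).
  have hK : is_derive x 1 (- K \*: (id : R -> R)) (- K *: 1).
    exact: is_deriveZ.
  apply: is_derive_eq => /=.
  by rewrite /GRing.scale /=; ring.
have [|c _] := MVT t0 (fun x _ => hg x).
  by apply: derivable_within_continuous => x _; case: (hg x).
rewrite -![g _]/(E _ * expR (- K * _)) mulr0 expR0 mulr1 => gE.
rewrite -(pmulr_lle0 _ (expR_gt0 (- K * t))) //.
have : expR (- K * c) * (dE c - K * E c) * (t - 0) <= 0.
  rewrite subr0 pmulr_lle0// pmulr_rle0 ?expR_gt0// subr_le0; exact: hle.
by rewrite -gE; lra.
Qed.

(** Energy estimate: the sum of squares [E] satisfies [E' <= K E], where [K] is twice the sum of the
    absolute values of the entries of [A], so Gronwall forces [E] to vanish. *)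
Lemma linear_ode_eq0_ge0 (R : realType) (m : nat) (A : 'M[R]_m)
    (y : 'I_m -> R -> R) :
  (forall i (t : R), is_derive t 1 (y i) (\sum_(j < m) A i j * y j t)) ->
  (forall i, y i 0 = 0) -> forall i t, 0 <= t -> y i t = 0.
Proof.
move=> dy y0 i t t0.
pose E : R -> R := \sum_(i < m) (y i ^+ 2).
have EE x : E x = \sum_(i < m) y i x ^+ 2.
  by rewrite /E fct_sumE; apply: eq_bigr.
have yE k x : y k x ^+ 2 <= E x.
  rewrite EE (bigD1 k)//= lerDl.
  by apply: sumr_ge0 => j _; exact: sqr_ge0.
have Et : E t <= 0.
  apply: (@gronwall_le0 _ E
    (fun x => \sum_(i < m) (2 * y i x) * \sum_(j < m) A i j * y j x)
    (2 * \sum_(i < m) \sum_(j < m) `|A i j|)) => //.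
  - move=> x; rewrite -mulrA mulr_suml mulr_sumr; apply: ler_sum => k _.
    rewrite -mulrA ler_pM2l// mulr_suml mulr_sumr; apply: ler_sum => j _.
    rewrite mulrCA (le_trans (ler_norm _))// normrM ler_wpM2l// ler_norml.
    (* Expanding the squares of [y k x + y j x] and [y k x - y j x] bounds twice [|y k x * y j x|]
       by [y k x ^+ 2 + y j x ^+ 2], hence by [2 * E x]. *)
    have := yE k x; have := yE j x.
    have := sqr_ge0 (y k x - y j x); have := sqr_ge0 (y k x + y j x).
    by rewrite !expr2 => h1 h2 h3 h4; apply/andP; split; lra.
  - by rewrite EE big1// => k _; rewrite y0 expr0n.
apply/eqP; rewrite -sqrf_eq0 eq_le sqr_ge0 andbT.
exact: le_trans (yE i t) Et.
Qed.

Lemma linear_ode_eq0 (R : realType) (m : nat) (A : 'M[R]_m)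
    (y : 'I_m -> R -> R) :
  (forall i (t : R), is_derive t 1 (y i) (\sum_(j < m) A i j * y j t)) ->
  (forall i, y i 0 = 0) -> forall i t, y i t = 0.
Proof.
move=> dy y0 i t; have [t0|/ltW t0] := leP 0 t.
  exact: (linear_ode_eq0_ge0 dy).
(* Time reversal: [u |-> y (- u)] solves the system with matrix [- A]. *)
rewrite -[t]opprK -[LHS]/((fun k => y k \o -%R) i (- t)).
apply: (@linear_ode_eq0_ge0 _ _ (- A)); last by rewrite oppr_ge0.
  move=> k x; apply: is_derive_eq.
  rewrite mulrN1 -sumrN; apply: eq_bigr => j _.
  by rewrite mxE mulNr.
by move=> k /=; rewrite oppr0.
Qed.

(** Ranks of finite samples are bounded by [N], so some sample attains the maximal rank; adjoining
    any further [v t] cannot enlarge its row space. *)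
Lemma finite_generating_family (F : fieldType) (T : Type) (N : nat)
    (v : T -> 'rV[F]_N) :
  exists m (s : 'I_m -> T), forall t, (v t <= \matrix_(i < m) v (s i))%MS.
Proof.
pose P r := `[< exists m (s : 'I_m -> T), \rank (\matrix_(i < m) v (s i)) = r >].
have exP : exists r, P r.
  exists (\rank (\matrix_(i < 0) (0 : 'rV[F]_N))); apply/asboolP.
  (* The empty sample is available even when [T] is empty. *)
  exists 0%N, (fun i : 'I_0 => False_rect T (notF (ltn_ord i))).
  by congr (\rank _); apply/matrixP => -[].
have boundP r : P r -> (r <= N)%N.
  by move=> /asboolP[m [s <-]]; exact: rank_leq_col.
case: (ex_maxnP exP boundP) => r /asboolP[m [s rs]] rmax.
exists m, s => t.
pose s' (i : 'I_(1 + m)) :=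
  match fintype.split i with inl _ => t | inr j => s j end.
have -> : v t = row ord0 (\matrix_(i < 1 + m) v (s' i)).
  by rewrite rowK /s'; case: fintype.splitP.
apply: submx_trans (row_sub _ _) _.
have sM : (\matrix_(i < m) v (s i) <= \matrix_(i < 1 + m) v (s' i))%MS.
  apply/row_subP => j; rewrite rowK.
  have -> : v (s j) = row (rshift 1 j) (\matrix_(i < 1 + m) v (s' i)).
    by rewrite rowK /s' -[rshift 1 j]/(unsplit (inr j)) unsplitK.
  exact: row_sub.
rewrite -(mxrank_leqif_sup sM) eqn_leq mxrankS//= rs.
by apply: rmax; apply/asboolP; exists (1 + m)%N, s'.
Qed.

Lemma linear_ode_shift (R : realType) (m : nat) (A : 'M[R]_m)
    (phi : 'I_m -> R -> R) (h : R) :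
  (forall i (t : R), is_derive t 1 (phi i) (\sum_(j < m) A i j * phi j t)) ->
  exists C : 'M[R]_m, forall t, fun_col phi (t + h) = C *m fun_col phi t.
Proof.
move=> dphi; pose v t := (fun_col phi t)^T.
have [k [s vs]] := finite_generating_family v.
pose M := \matrix_(i < k) v (s i).
pose N := \matrix_(i < k) v (s i + h).
(* The rows of [M] may be dependent; the pseudo-inverse selects weights [w] with [w *m M = v t] that
   depend linearly on [v t]. The transpose returns from rows to columns. *)
exists (pinvmx M *m N)^T => t; apply: trmx_inj; rewrite trmx_mul trmxK.
rewrite -!/(v _) mulmxA; set w := v t *m pinvmx M.
have wM : w *m M = v t by exact: mulmxKpV.
pose y i u := phi i (t + u) - \sum_(l < k) w ord0 l * phi i (s l + u).
have dshift i (x u : R) : is_derive u 1 (fun z => phi i (x + z))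
    (\sum_(j < m) A i j * phi j (x + u)).
  have dx : is_derive u 1 (fun z : R => x + z) 1.
    by apply: (@is_derive_eq _ _ _ (cst x + id)); rewrite add0r.
  have := is_derive1_comp (dphi i (x + u)) dx.
  by rewrite mulr1.
have y0 i u : y i u = 0.
  apply: (@linear_ode_eq0 _ _ A) => {i u} [i u|i]; last first.
    rewrite /y addr0; apply/eqP; rewrite subr_eq0; apply/eqP.
    have := congr1 (fun X : 'rV_m => X ord0 i) wM.
    rewrite /v !mxE => <-; apply: eq_bigr => l _.
    by rewrite !mxE addr0.
  have -> : y i = (fun z => phi i (t + z)) -
      \sum_(l < k) (w ord0 l \*: (fun z => phi i (s l + z))).
    by apply/funext => z; rewrite /y fctE fct_sumE.
  apply: is_derive_eq.
  rewrite /y; under [RHS]eq_bigr do rewrite mulrBr mulr_sumr.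
  rewrite sumrB exchange_big/=; congr (_ - _); apply: eq_bigr => l _.
  by rewrite /GRing.scale /= mulr_sumr; apply: eq_bigr => j _; rewrite mulrCA.
apply/rowP => i; have /eqP := y0 i h; rewrite subr_eq0 => /eqP.
rewrite /v !mxE => ->; apply: eq_bigr => l _.
by rewrite !mxE.
Qed.

Lemma fun_span_subset (R : realType) (m : nat) (phi psi : 'I_m -> R -> R)
    (C : 'M[R]_m) :
  (forall t, fun_col phi t = C *m fun_col psi t) ->
  fun_span phi `<=` fun_span psi.
Proof.
move=> phiE _ [c ->]; exists (fun j => \sum_(i < m) c i * C i j).
apply/funext => t; under [RHS]eq_bigr do rewrite mulr_suml.
rewrite exchange_big; apply: eq_bigr => i _ /=.
have := congr1 (fun X : 'cV_m => X i ord0) (phiE t); rewrite !mxE => ->.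
by rewrite mulr_sumr; apply: eq_bigr => j _; rewrite mxE mulrA.
Qed.

Theorem proposition2p3 (R : realType) (n : nat) (phi : 'I_n.+1 -> R -> R)
    (phi_diff : forall (i : 'I_n.+1) (t : R), derivable (phi i) t 1)
    (Omega_closed : closed_under_differentiation (fun_span phi))
    (h : R) :
  fun_span phi = fun_span (fun (i : 'I_n.+1) (t : R) => phi i (t + h)) /\
  exists C : 'M[R]_n.+1, forall t : R, fun_col phi (t + h) = C *m fun_col phi t.
Proof.
have span_phi i : fun_span phi (phi i).
  exists (fun j => (j == i)%:R); apply/funext => t.
  rewrite (bigD1 i)//= eqxx mul1r big1 ?addr0// => j /negPf->.
  by rewrite mul0r.
(* For a dependent family these coefficients are not unique; any choice will do. *)
have /choice[a aE] i := Omega_closed _ (span_phi i).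
have dphi i (t : R) : is_derive t 1 (phi i)
    (\sum_(j < n.+1) (\matrix_(i, j) a i j) i j * phi j t).
  apply: DeriveDef => //; rewrite -derive1E aE.
  by apply: eq_bigr => j _; rewrite mxE.
have [C CE] := linear_ode_shift h dphi.
split; last by exists C.
(* Shifting back by [- h] from [t + h] expresses [phi] through its translates, which gives the first
   inclusion. *)
have [D DE] := linear_ode_shift (- h) dphi.
apply/seteqP; split.
- apply: (@fun_span_subset _ _ _ _ D) => t.
  by rewrite -{1}(addrK h t) DE.
- exact: (@fun_span_subset _ _ _ _ C).
Qed.
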